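(* Assume that for any $\epsilon>0$ there is $N\in\mathbb{N}$ such that for all $n\ge N$: $\sup_{\alpha\in\Theta}P_{\alpha,n}(\cup_{j=1}^{m_n-1}K_{n,j}^c)<\epsilon$ and $\sup_{\alpha\in\Theta}\tilde P_{\alpha,n}(\cup_{j=1}^{m_n-1}K_{n,j}^c)<\epsilon$. Assume moreover that $$m_n\max_{1\le j\le m_n}\ \sup_{\alpha\in\Theta,\ \bar x_{j-1}\in\bar X_{j-1}(K_{n,j-1})}\int|p_j(\alpha)-\tilde p_j(\alpha)|\,\mu_{n,j}(dx_j)\to0\quad(n\to\infty),$$ where for $j=1$ the restriction on $\bar x_0$ is ignored. Then $\sup_{\alpha\in\Theta}\|P_{\alpha,n}-\tilde P_{\alpha,n}\|\to0$ as $n\to\infty$, where $\|\cdot\|$ is the total variation norm. If, further, for any $\epsilon>0$ and $h\in\mathbb{R}^d$ there exists $\delta>0$ such that $$\limsup_{n\to\infty}\tilde P_{\alpha_0,n}\bigg(\frac{d\tilde P_{\alpha_h,n}}{d\tilde P_{\alpha_0,n}}<\delta\bigg)<\epsilon,$$ then $$\log\frac{dP_{\alpha_h,n}}{dP_{\alpha_0,n}}-\log\frac{d\tilde P_{\alpha_h,n}}{d\tilde P_{\alpha_0,n}}\to0$$ as $n\to\infty$ in $P_{\alpha_0,n}$-probability and in $\tilde P_{\alpha_0,n}$-probability, for any $h\in\mathbb{R}^d$.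
   Context: Setting. Let $\Theta\subset\mathbb{R}^d$ be open, $\alpha_0\in\Theta$, and let $(m_n)_{n\ge1}$ be positive integers. For each $n$ let $\mathcal{X}_{n,1},\dots,\mathcal{X}_{n,m_n}$ be complete separable metric spaces, $\mathcal{X}_n=\mathcal{X}_{n,1}\times\cdots\times\mathcal{X}_{n,m_n}$, $\mathcal{A}_n=\mathcal{B}(\mathcal{X}_n)$, and let $\{P_{\alpha,n}\}_{\alpha\in\Theta}$ be probability measures on $(\mathcal{X}_n,\mathcal{A}_n)$. Let $X_j:\mathcal{X}_n\to\mathcal{X}_{n,j}$ be the natural projection, $\bar X_j=(X_1,\dots,X_j)$, $\bar{\mathcal{X}}_{n,j}=\mathcal{X}_{n,1}\times\cdots\times\mathcal{X}_{n,j}$, $\mathcal{A}_{0,n}=\{\emptyset,\mathcal{X}_n\}$, $\mathcal{A}_{j,n}=\sigma(\bar X_j)$. Suppose there are $\sigma$-finite measures $\mu_{n,j}$ on $\mathcal{X}_{n,j}$ with $P_{\alpha,n}(X_1\in\cdot)\ll\mu_{n,1}$ and $P_{\alpha,n}(X_j\in\cdot|\bar X_{j-1}=\bar x_{j-1})\ll\mu_{n,j}$ ($2\le j\le m_n$, $\bar x_{j-1}\in\bar{\mathcal{X}}_{n,j-1}$); $p_j(\alpha)=p_j(\alpha,x_j,\bar x_{j-1})$ denotes the corresponding (conditional) density ($\bar x_0=\emptyset$). Let $\epsilon_n$ be nondegenerate $d\times d$ matrices with $\|\epsilon_n\|_{\rm op}\to0$ and $\alpha_h=\alpha_0+\epsilon_nh$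 (for each $h$, only $n$ so large that $\alpha_h\in\Theta$ are considered). Approximating measures. Let $\tilde p_1(\alpha)=\tilde p_1(\alpha,x_1)$ and $\tilde p_j(\alpha)=\tilde p_j(\alpha,x_j,\bar x_{j-1})$ be nonnegative functions (not necessarily probability densities) such that $\tilde p_1(\alpha,\cdot)$ is measurable and $(\bar x_{j-1},A)\mapsto\int_A\tilde p_j(\alpha,x_j,\bar x_{j-1})\mu_{n,j}(dx_j)$ is a transition kernel for $2\le j\le m_n$. Put $d_j(\bar x_{j-1},\alpha)=\int\tilde p_j(\alpha)\,\mu_{n,j}(dx_j)$, assumed nonzero and finite for all $(\bar x_{j-1},\alpha)$, and let $\tilde P_{\alpha,n}$ be the probability measure $\prod_{j=1}^{m_n}\frac{\tilde p_j(\alpha)}{d_j(\alpha)}\bigotimes_{j=1}^{m_n}\mu_{n,j}(dx_j)$ on $\mathcal{X}_n$. Let $K_{n,j}\in\mathcal{A}_{j,n}$ for $1\le j\le m_n-1$, and let $\bar X_{j-1}(K_{n,j-1})$ denote the image of $K_{n,j-1}$ under $\bar X_{j-1}$. Radon--Nikodym derivatives between these measures denote those of the absolutely continuous part, as usual in likelihood ratios. *)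

(* Defs.v *)
From HB Require Import structures.
From mathcomp Require Import all_boot all_order all_algebra.
From mathcomp Require Import all_classical all_reals all_analysis.
From mathcomp Require Import measurable_realfun.

Set Implicit Arguments.
Unset Strict Implicit.
Unset Printing Implicit Defensive.
Import Order.TTheory GRing.Theory Num.Theory.
Import numFieldNormedType.Exports.
Local Open Scope classical_set_scope.
Local Open Scope ring_scope.

#[short(type="completeMetricType")]
HB.structure Definition CompleteMetric (R : numDomainType) :=
  {T of Complete T & Metric R T}.

Definition separable (T : topologicalType) : Prop :=
  exists2 S : set T, countable S & dense S.

Definition borel (T : ptopologicalType) := g_sigma_algebraType (@open T).
HB.instance Definition _ (T : ptopologicalType) := Measurable.on (borel T).

Section euclidean_operator_norm.
Context {R : realType}.

(* The library norm on matrices is the entrywise maximum. *)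
Definition euclid_norm (d : nat) (v : 'cV[R]_d) : R :=
  Num.sqrt (\sum_(i < d) v i ord0 ^+ 2).

Definition op_norm (d : nat) (A : 'M[R]_d) : R :=
  sup [set euclid_norm (A *m v) | v in [set v | euclid_norm v <= 1]].

End euclidean_operator_norm.

(* Coordinates are numbered from 0. [prodX X k] is the product of the first k
   spaces X 0, ..., X k.-1, a single point for k = 0, with the product
   topology. Spaces of index at least k play no role in it. *)
Definition prodX (R : realType) (X : nat -> completeMetricType R) (k : nat) :=
  prod_topology (fun i : 'I_k => X i).
HB.instance Definition _ (R : realType) (X : nat -> completeMetricType R)
  (k : nat) := Topological.copy (prodX X k) (prod_topology (fun i : 'I_k => X i)).
HB.instance Definition _ (R : realType) (X : nat -> completeMetricType R)
  (k : nat) := isPointed.Build (prodX X k) (fun=> point).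

Section products.
Context {R : realType} {X : nat -> completeMetricType R}.

(* The first j coordinates, i.e. those that precede the one of index j. *)
Definition past (m : nat) (j : 'I_m) (x : prodX X m) : prodX X j :=
  fun i => x (widen_ord (ltnW (ltn_ord j)) i).

Fact rcons_index (k : nat) (i : 'I_k.+1) : ~~ (i < k)%N -> k = i.
Proof.
by rewrite -leqNgt => ki; apply/eqP; rewrite eqn_leq ki -ltnS ltn_ord.
Qed.

Definition rconsX (k : nat) (h : prodX X k) (x : X k) : prodX X k.+1 :=
  fun i => match boolP (i < k)%N with
           | AltTrue lt_ik => h (Ordinal lt_ik)
           | AltFalse ge_ik => ecast j (X j) (rcons_index ge_ik) x
           end.

End products.
Arguments past {R X m} j x i.

Section measures.
Context {R : realType}.
Local Open Scope ereal_scope.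

(* Integral of F against mu 0 (dx_0) ... mu m.-1 (dx_m.-1), the last
   coordinate being integrated first. The order matters when only the
   sections of F in each coordinate are assumed measurable. *)
Fixpoint iterated_integral (X : nat -> completeMetricType R)
    (mu : forall j, {sigma_finite_measure set borel (X j) -> \bar R}) (m : nat) :
    (prodX X m -> \bar R) -> \bar R :=
  match m with
  | 0%N => fun F => F point
  | k.+1 => fun F =>
      iterated_integral mu (fun h : prodX X k => \int[mu k]_x F (rconsX h x))
  end.

(* The density prod_j q_j / d_j, where d_j is the integral of q_j over the
   coordinate of index j. *)
Definition normalized_product (X : nat -> completeMetricType R)
    (mu : forall j, {sigma_finite_measure set borel (X j) -> \bar R}) (m : nat)
    (q : forall j : 'I_m, prodX X j -> X j -> R) (x : prodX X m) : R :=
  \prod_(j < m) (q j (past j x) (x j)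
                 / fine (\int[mu j]_t (q j (past j x) t)%:E))%R.

(* The total mass of the variation of nu, independent of the chosen Hahn
   decomposition. For a difference P - Q of probabilities it is twice the
   supremum of |P A - Q A| over the measurable sets A. *)
Definition tv_norm d (T : measurableType d) (nu : {charge set T -> \bar R}) :
    \bar R :=
  charge_variation (projT2 (cid (projT2 (cid (Hahn_decomposition nu))))) setT.

Definition charge_sub d (T : measurableType d) (P Q : probability T R) :=
  cadd (charge_of_finite_measure P) (copp (charge_of_finite_measure Q)).

Definition is_density d (T : measurableType d) (mu nu : set T -> \bar R)
    (f : T -> R) : Prop :=
  [/\ measurable_fun setT f, forall x, (0 <= f x)%R &
      forall A, measurable A -> nu A = \int[mu]_(x in A) (f x)%:E].

(* Q is a regular conditional distribution of Z given Y under P. *)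
Definition is_conditional_law d d1 d2 (T : measurableType d)
    (T1 : measurableType d1) (T2 : measurableType d2) (P : probability T R)
    (Y : T -> T1) (Z : T -> T2) (Q : R.-pker T1 ~> T2) : Prop :=
  forall B A, measurable B -> measurable A ->
    P (Y @^-1` B `&` Z @^-1` A) = \int[P]_(t in Y @^-1` B) Q (Y t) A.

(* f is a version of the density, with respect to P, of the absolutely
   continuous part in the Lebesgue decomposition of Q. *)
Definition is_ac_derivative d (T : measurableType d) (Q P : probability T R)
    (f : T -> \bar R) : Prop :=
  [/\ measurable_fun setT f, forall x, 0 <= f x &
      exists Qa Qs : {measure set T -> \bar R},
        [/\ forall A, measurable A -> Q A = Qa A + Qs A,
            Qa `<< P,
            exists N, [/\ measurable N, P N = 0 & Qs (~` N) = 0] &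
            forall A, measurable A -> Qa A = \int[P]_(x in A) f x]].

(* When Z n is a difference of logarithms, an undefined difference oo - oo
   is infinite in the library's convention, so it counts as a deviation. *)
Definition cvg0_in_probability (d : nat -> measure_display)
    (T : forall n, measurableType (d n)) (P : forall n, probability (T n) R)
    (Z : forall n, T n -> \bar R) : Prop :=
  forall e : R, (0 < e)%R ->
    P n [set x | e%:E <= `|Z n x|] @[n --> \oo] --> 0.

End measures.

(* Main.v *)
Require Import Defs.
From HB Require Import structures.
From mathcomp Require Import all_boot all_order all_algebra.
From mathcomp Require Import all_classical all_reals all_analysis.
From mathcomp Require Import measurable_realfun lra.

Set Implicit Arguments.
Unset Strict Implicit.
Unset Printing Implicit Defensive.
Import Order.TTheory GRing.Theory Num.Theory.
Import numFieldNormedType.Exports.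
Local Open Scope classical_set_scope.
Local Open Scope ring_scope.
Local Open Scope ereal_scope.

(** The proof is a telescoping argument followed by a computation on sets.

    For fixed n and alpha, both P and Pt are laws of a sequence built one
    coordinate at a time: with T_k F (h) the integral of F over the next
    coordinate under the transition kernel at the history h, the measure of A is
    T_0 (T_1 (.. (T_(m-1) 1_A))). For P the kernels are the conditional laws
    ([integral_restr]), for Pt they are the kernels with densities pt / d
    ([iterated_integral_density]), where d normalizes pt. Since p integrates to
    1, d differs from 1 by at most the L1 distance c between p and pt, so that
    p and pt / d are at distance at most 2 c ([normalized_density_distance]).
    Replacing one kernel after the other thus changes the result by at most 2 c
    each time, provided that the history lies in the good set where c bounds the
    distance. If A is contained in the intersection of the K_j, all the functions
    T_k F vanish at the other histories, which hence contribute nothing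
    ([kernel_integral_le]). In total P A and Pt A differ by at most 2 m c plus the
    mass outside the K_j ([probability_difference_le]), uniformly in A and alpha.
    This is convergence in total variation ([tv_norm_le]).

    Measurability in the history is a property of the kernels, not of the
    densities, so everything is phrased with kernels. These act on the product
    sigma-algebra of history times next coordinate, while the measures live on
    the Borel sets of the product space; that the former contains the latter is
    where separability enters ([measurable_rconsX]).

    For the likelihood ratios write L = dP1/dP0, Lt = dQ1/dQ0, where P0, Q0 and
    P1, Q1 are t-close in total variation. Let A be the set where
    dl <= Lt <= M and r Lt <= L, with r > 1. Then
      r int_A Lt dP0 <= int_A L dP0 = P1 A <= Q1 A + t = int_A Lt dQ0 + t,
    and int_A Lt dP0 is within M t of int_A Lt dQ0 because Lt is bounded by M on
    A ([integral_le_add_bound]). Hence (r - 1) int_A Lt dQ0 is of order t, and so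
    is Q0 A since Lt >= dl there. The set where L is too small is
    treated alike ([ratio_set_le]). What is left is the event Lt > M, small
    by Markov's inequality, and the event Lt < dl, small by the hypothesis on the
    lower tail ([log_ratio_deviation_le]). *)

(** * Integration against mixtures and conditional laws *)

Section mixtures.
Context d d' (W : measurableType d) (Z : measurableType d') (R : realType).
Variables (rho : {measure set W -> \bar R}) (kap : W -> {measure set Z -> \bar R}).
Variable nu : {measure set Z -> \bar R}.
Hypothesis mkap : forall A, measurable A -> measurable_fun setT (kap ^~ A).
Hypothesis nuE : forall A, measurable A -> nu A = \int[rho]_w kap w A.

Import HBNNSimple.

Let mixture_nnsfun (f : {nnsfun Z >-> R}) :
  \int[nu]_z (f z)%:E = \int[rho]_w \int[kap w]_z (f z)%:E.
Proof.
transitivity (\int[rho]_w \sum_(r \in range f) (r%:E * kap w (f @^-1` [set r])));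
    last by apply: eq_integral => w _; rewrite integralT_nnsfun sintegralE.
rewrite integralT_nnsfun sintegralE ge0_integral_fsum//; first last.
- by move=> r w _; apply: (mulemu_ge0 (fun r => f @^-1` [set r])) => /preimage_nnfun0.
- by move=> r; apply: measurable_funeM; exact: mkap.
apply: eq_fsbigr => r _; rewrite nuE//.
have [r0|r0] := leP 0%R r; first by rewrite ge0_integralZl//; exact: mkap.
rewrite preimage_nnfun0// integral0_eq ?mule0.
  by rewrite integral0_eq// => w _; rewrite measure0 mule0.
by move=> w _; rewrite measure0.
Qed.

(** Both sides are additive in f and continuous along increasing sequences, so
    the case of indicators decides. Densities and conditional laws are both
    instances. *)
Lemma integral_mixture (f : Z -> \bar R) :
  measurable_fun setT f -> (forall z, 0 <= f z) ->
  \int[nu]_z f z = \int[rho]_w \int[kap w]_z f z.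
Proof.
move=> mf f0; pose f_ := nnsfun_approx measurableT mf.
have limf (m : {measure set Z -> \bar R}) :
    \int[m]_z f z = limn (fun n => \int[m]_z (f_ n z)%:E).
  rewrite -monotone_convergence//.
  - by apply: eq_integral => z _; apply/esym/cvg_lim => //; exact: cvg_nnsfun_approx.
  - by move=> n; exact/measurable_EFinP.
  - by move=> n z _; rewrite lee_fin.
  - by move=> z _ a b ab; rewrite lee_fin; exact/lefP/nd_nnsfun_approx.
rewrite limf (_ : (fun n => _) = fun n => \int[rho]_w \int[kap w]_z (f_ n z)%:E);
  last by apply/funext => n; rewrite mixture_nnsfun.
rewrite -monotone_convergence//.
- by apply: eq_integral => w _; rewrite limf.
- move=> n; apply: measurable_fun_integral_kernel => //.
  + by move=> z; rewrite lee_fin.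
  + exact/measurable_EFinP.
- by move=> n w _; apply: integral_ge0 => z _; rewrite lee_fin.
- move=> w _ a b ab; apply: ge0_le_integral => //.
  + by move=> z _; rewrite lee_fin.
  + exact/measurable_EFinP.
  + exact/measurable_EFinP.
  + by move=> z _; rewrite lee_fin; exact/lefP/nd_nnsfun_approx.
Qed.

End mixtures.

(** A measure with density g is the mixture of the masses g x at the points x. *)
Lemma integral_density d (T : measurableType d) (R : realType)
    (mu nu : {measure set T -> \bar R}) (g : T -> R) (f : T -> \bar R) :
  is_density mu nu g -> measurable_fun setT f -> (forall x, 0 <= f x) ->
  \int[nu]_x f x = \int[mu]_x (f x * (g x)%:E).
Proof.
move=> [mg g0 nuE] mf f0.
pose kap x : {measure set T -> \bar R} := mscale (NngNum (g0 x)) \d_x.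
rewrite (@integral_mixture _ _ _ _ _ mu kap)//.
- apply: eq_integral => x _; rewrite ge0_integral_mscale//.
  by rewrite integral_dirac// diracT mul1e muleC.
- move=> A mA; rewrite /kap/= /mscale/=; apply: emeasurable_funM.
    exact/measurable_EFinP.
  exact: measurable_fun_dirac.
- move=> A mA; rewrite nuE// integral_mkcond; apply: eq_integral => x _.
  rewrite /kap/= /mscale/= diracE patchE.
  by case: (x \in A); rewrite ?mule1 ?mule0.
Qed.

(** Packs the measurability proof, on which the measure structure of a
    push-forward depends, so that families of push-forwards can be formed. *)
Definition image_measure d1 d2 (T1 : measurableType d1) (T2 : measurableType d2)
    (R : realType) (m : {measure set T1 -> \bar R}) (f : T1 -> T2)
    (mf : measurable_fun setT f) : {measure set T2 -> \bar R}.
Proof. by refine (pushforward m f); exact: mf. Defined.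

(** The definition of a conditional law determines the law of (Y, Z) on
    rectangles, hence everywhere by the pi-lambda theorem; that law is then a
    mixture of the laws of (y, Z) with Z drawn from Q y. *)
Lemma integral_conditional_law (R : realType) d d1 d2 (T : measurableType d)
    (T1 : measurableType d1) (T2 : measurableType d2) (P : probability T R)
    (Y : T -> T1) (Z : T -> T2) (Q : R.-pker T1 ~> T2) (F : T1 * T2 -> \bar R) :
  measurable_fun setT Y -> measurable_fun setT Z ->
  is_conditional_law P Y Z Q ->
  measurable_fun setT F -> (forall z, 0 <= F z) ->
  \int[P]_t F (Y t, Z t) = \int[P]_t \int[Q (Y t)]_z F (Y t, z).
Proof.
move=> mY mZ PQ mF F0.
have mYZ : measurable_fun setT (fun t => (Y t, Z t)).
  exact/measurable_fun_pairP.
rewrite -[LHS]/(\int[P]_t (F \o (fun t => (Y t, Z t))) t).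
pose nu : {measure set (T1 * T2) -> \bar R} := image_measure P mYZ.
pose kap t : {measure set (T1 * T2) -> \bar R} :=
  image_measure (Q (Y t)) (pair1_measurable (Y t)).
have kapE t A : kap t A = Q (Y t) (xsection A (Y t)).
  by rewrite /kap/= /pushforward xsectionE.
have kap1 t : kap t setT = 1.
  by rewrite kapE xsectionE preimage_setT prob_kernel.
have mkap A : measurable A -> measurable_fun setT (kap ^~ A).
  move=> mA; under eq_fun do rewrite kapE.
  apply: (measurableT_comp (f := fun y => Q y (xsection A y))) => //.
  by apply: measurable_fun_xsection_finite_kernel; rewrite inE.
transitivity (\int[nu]_z F z).
  by rewrite ge0_integral_pushforward.
rewrite (@integral_mixture _ _ _ _ _ P kap)//.
  by apply: eq_integral => t _; rewrite ge0_integral_pushforward.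
rewrite measurable_prod_measurableType.
apply: (@dynkin_induction _ _ _ (fun A => nu A = \int[P]_t kap t A)).
- exact: measurable_prod_measurableType.
- move=> _ _ [A1 mA1 [A2 mA2 <-]] [B1 mB1 [B2 mB2 <-]].
  exists (A1 `&` B1); first exact: measurableI.
  by exists (A2 `&` B2); [exact: measurableI|rewrite setXI].
- rewrite [LHS]probability_setT.
  transitivity (\int[P]_t cst 1 t).
    by rewrite integral_cst// mul1e; exact/esym/probability_setT.
  by apply: eq_integral => t _; rewrite kap1.
- move=> _ [A mA [B mB <-]]; rewrite -[LHS]/(P _).
  rewrite (_ : _ @^-1` _ = Y @^-1` A `&` Z @^-1` B)// PQ// integral_mkcond.
  apply: eq_integral => t _; rewrite kapE patchE.
  have [tA|tA] := boolP (t \in Y @^-1` A).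
    by rewrite in_xsectionX//; move: tA; rewrite !inE.
  by rewrite notin_xsectionX ?measure0//; move: tA; rewrite !inE.
- move=> S mS SE.
  have fin1 : \int[P]_t kap t S \is a fin_num 
    by rewrite -SE; apply: fin_num_measure; rewrite -[_ @^-1` _]setTI; exact: (mYZ).
  rewrite -[LHS](addeK _ fin1) -[RHS](addeK _ fin1); congr (_ - _).
  rewrite -{1}SE -measureU ?setICl//; last exact: measurableC.
  rewrite setUCl -ge0_integralD//; [|exact/mkap/measurableC|exact: mkap].
  rewrite [LHS]probability_setT.
  transitivity (\int[P]_t cst 1 t).
    by rewrite integral_cst// mul1e; exact/esym/probability_setT.
  apply: eq_integral => t _; rewrite -measureU ?setICl//; last exact: measurableC.
  by rewrite setUCl; exact/esym/kap1.
- move=> F' mF' tF' IH; rewrite measure_bigcup//.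
  rewrite (@eq_eseriesl R _ xpredT _ _ (fun k => in_setT k)).
  rewrite (eq_eseriesr (fun k _ => IH k)).
  rewrite -integral_nneseries//.
    apply: eq_integral => t _; rewrite measure_bigcup//.
    by rewrite (@eq_eseriesl R _ xpredT _ _ (fun k => in_setT k)).
  by move=> k; exact: mkap.
Qed.
(** * Measurability on products of separable metric spaces *)

Lemma separable_second_countable (R : realType) (T : metricType R) :
  separable T -> second_countable (T := T).
Proof.
move=> [S cS dS].
pose f (z : T * nat) : set T := (ball z.1 (z.2.+1%:R^-1 : R)%R)°.
exists (f @` (S `*` setT)).
  exact/(sub_countable (card_image_le _ _))/countableX.
split; first by move=> _ [z _ <-]; exact: open_interior.
move=> x V /nbhs_ballP [_/posnumP[e] xeV].
have [N _ deleps] : exists2 N : nat, setT N & (N.+1%:R^-1 < e%:num / 2 :> R)%R.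
  have [//|N] := @ltr_add_invr R 0%R (e%:num / 2) _.
  by rewrite add0r => ?; exists N.
pose r : R := (N.+1%:R^-1)%R.
have r0 : (0 < r)%R by rewrite invr_gt0.
have [y [Sy xy]] : S `&` (ball x (r / 2)%R)° !=set0.
  rewrite setIC; apply: dS; last exact: open_interior.
  by exists x; apply: nbhsx_ballx; exact: divr_gt0.
exists (f (y, N)); first split; first by exists (y, N).
  apply: filterS (nbhsx_ballx x (r / 2)%R _); last exact: divr_gt0.
  move=> z xz; rewrite /= -/r [r]splitr; apply: (@ball_triangle _ _ x) => //.
  by apply: ball_sym; exact: interior_subset xy.
move=> z /interior_subset/= yz; apply: xeV.
rewrite [_%:num]splitr; apply: (@ball_triangle _ _ y).
  apply: (@le_ball _ _ _ (r / 2)%R); last exact: interior_subset xy.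
  by apply: le_trans (ltW deleps); rewrite ler_pdivrMr// ler_peMr ?ltW// ltr1n.
by apply: (le_ball (ltW deleps)).
Qed.

Lemma continuous_borel_measurable (T U : ptopologicalType) (f : T -> U) :
  continuous f -> measurable_fun setT (f : borel T -> borel U).
Proof.
move=> /continuousP cf; apply: (@measurability _ _ _ (borel U) _ _ (@open U)) => //.
by move=> _ [A oA <-]; rewrite setTI; apply: sub_sigma_algebra; exact: cf.
Qed.

Lemma continuous_to_product (I : Type) (T : I -> topologicalType)
    (Z : topologicalType) (f : Z -> prod_topology T) :
  (forall i, continuous (fun z => f z i)) -> continuous f.
Proof.
move=> cf z; apply/cvg_sup => i U [V [[W oW <-] Wfz] VU].
by apply: filterS VU _; apply: (cf i z); exact: open_nbhs_nbhs.
Qed.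

(** An open set of a product is a countable union of open rectangles as soon
    as one of the two factors has a countable base: for each basic open set V
    of that factor, take the largest open U with U * V inside the set. *)
Lemma continuous2_borel_measurable (S T U : ptopologicalType) (f : S * T -> U) :
  second_countable (T := T) -> continuous f ->
  measurable_fun setT (f : borel S * borel T -> borel U).
Proof.
move=> [B cB [Bo Bbase]] /continuousP cf.
apply: (@measurability _ _ _ (borel U) _ _ (@open U)) => //.
move=> _ [A oA <-]; rewrite setTI.
pose O : set (S * T) := f @^-1` A.
have oO : open O by exact: cf.
pose big V := \bigcup_(W in [set W : set S | open W /\ W `*` V `<=` O]) W.
have -> : f @^-1` A = \bigcup_(V in B) (big V `*` V).
  apply/seteqP; split=> [[s t] Ost|[s t] [V BV [/= [W [oW WV] Ws] Vt]]]; last first.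
    exact: (WV (s, t)).
  have [[P Q] /= [Ps Qt] PQ] : nbhs (s, t) O by exact: open_nbhs_nbhs.
  have [V [BV Vt] VQ] := Bbase t _ Qt.
  exists V => //; split => //=; exists P°; last exact: Ps.
  by split=> [|[s' t'] [/= /interior_subset Ps' /VQ Qt']];
    [exact: open_interior|exact: PQ].
move: cB => /countable_injP[e /= einj].
rewrite (_ : \bigcup_(V in B) _ =
    \bigcup_n \bigcup_(V in B `&` e @^-1` [set n]) (big V `*` V)); last first.
  apply/seteqP; split=> [z [V BV zV]|z [n _ [V [BV _] zV]]]; last by exists V.
  by exists (e V) => //; exists V.
apply: bigcupT_measurable => n.
have [->|/set0P[V [BV eV]]] := eqVneq (B `&` e @^-1` [set n]) set0.
  by rewrite bigcup_set0.
rewrite (_ : B `&` _ = [set V]) ?bigcup_set1; last first.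
  apply/seteqP; split=> [V' [BV' eV']|_ ->//].
  by apply: einj; rewrite ?inE// eV eV'.
apply: measurableX; apply: sub_sigma_algebra; last exact: Bo.
by apply: bigcup_open => W [].
Qed.

Section histories.
Context {R : realType} {X : nat -> completeMetricType R}.

(** [past] with a bound in place of an ordinal, so that all the coordinates may
    be kept. *)
Definition restr (j k : nat) (jk : (j <= k)%N) (x : prodX X k) : prodX X j :=
  fun i => x (widen_ord jk i).

(** Ordinals with the same value may carry different bounds, and the type of a
    coordinate depends on the value only. *)
Lemma coord_val k (x : prodX X k) (i j : 'I_k) (ij : i = j :> nat) :
  ecast n (X n) ij (x i) = x j.
Proof.
move: i j ij => [i ik] [j jk] /= ij; subst j => /=.
by rewrite (eq_irrelevance ik jk).
Qed.

Lemma restr_id k (kk : (k <= k)%N) (x : prodX X k) : restr kk x = x.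
Proof.
by apply: functional_extensionality_dep => i;
  exact: (@coord_val k x (widen_ord kk i) i erefl).
Qed.

Lemma rconsX_lt k (h : prodX X k) (x : X k) (i : 'I_k.+1) (ik : (i < k)%N) :
  rconsX h x i = h (Ordinal ik).
Proof.
rewrite /rconsX; destruct boolP as [lt|ge]; last by exfalso; rewrite ik in ge.
exact: (@coord_val k h (Ordinal lt) (Ordinal ik) erefl).
Qed.

Lemma restr_rconsX j k (jk : (j <= k)%N) (jk1 : (j <= k.+1)%N) (h : prodX X k)
  (x : X k) : restr jk1 (rconsX h x) = restr jk h.
Proof.
apply: functional_extensionality_dep => i.
have ik : (widen_ord jk1 i < k)%N by exact: leq_trans (ltn_ord i) jk.
by rewrite /restr (rconsX_lt _ _ ik);
  exact: (@coord_val k h (Ordinal ik) (widen_ord jk i) erefl).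
Qed.

Lemma rconsX_last k (i : 'I_k.+1) (ik : k = i) (h : prodX X k) (x : X k) :
  rconsX h x i = ecast j (X j) ik x.
Proof.
rewrite /rconsX; destruct boolP as [lt|ge].
  by exfalso; move: lt; rewrite {2}ik ltnn.
by rewrite (_ : rcons_index ge = ik)//; exact: eq_irrelevance.
Qed.

Lemma rconsX_ord_max k (h : prodX X k) (x : X k) : rconsX h x ord_max = x.
Proof. by rewrite (rconsX_last (erefl : k = ord_max :> nat)). Qed.

Lemma rconsX_restr m k (km : (k < m)%N) (x : prodX X m) :
  rconsX (restr (ltnW km) x) (x (Ordinal km)) = restr km x.
Proof.
apply: functional_extensionality_dep => i.
have [ik|ki] := ltnP i k.
  rewrite (rconsX_lt _ _ ik) /restr.
  exact: (@coord_val m x (widen_ord (ltnW km) (Ordinal ik)) (widen_ord km i) erefl).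
have ei : k = i by apply/eqP; rewrite eqn_leq ki -ltnS ltn_ord.
rewrite (rconsX_last ei).
exact: (@coord_val m x (Ordinal km) (widen_ord km i) ei).
Qed.

Lemma coord_continuous k (i : 'I_k) : continuous (fun x : prodX X k => x i).
Proof. refine (@proj_continuous _ (fun i : 'I_k => X i) i). Qed.

Lemma restr_continuous j k (jk : (j <= k)%N) : continuous (restr jk).
Proof.
by apply: continuous_to_product => i; exact: (@coord_continuous k (widen_ord jk i)).
Qed.

Lemma rconsX_continuous k :
  continuous (fun z : prodX X k * X k => rconsX z.1 z.2).
Proof.
apply: continuous_to_product => i.
have [ik|ki] := ltnP i k.
  rewrite (_ : (fun z => _) = (fun h : prodX X k => h (Ordinal ik)) \o fst).
    move=> z; apply: continuous_comp; first exact: cvg_fst.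
    exact: (@coord_continuous k (Ordinal ik)).
  by apply/funext => -[h x]; exact: rconsX_lt.
have ei : k = i by apply/eqP; rewrite eqn_leq ki -ltnS ltn_ord.
under eq_fun do rewrite (rconsX_last ei).
move: i ki ei => [i lti] /= _ ei; subst i => /= z.
exact: cvg_snd.
Qed.

End histories.
(** * Laws built from transition kernels *)

Section kernel_integrals.
Context {R : realType} {X : nat -> completeMetricType R}.
Variable m : nat.
Hypothesis X_second_countable :
  forall k, (k < m)%N -> second_countable (T := X k).

Definition kernel_step (Q : forall k, R.-pker borel (prodX X k) ~> borel (X k))
    (k : nat) (F : prodX X k.+1 -> \bar R) (h : prodX X k) : \bar R :=
  \int[Q k h]_x F (rconsX h x).

(** The integral of a function of k coordinates drawn successively from the
    kernels; the recursion is that of [iterated_integral]. The family of kernels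
    is indexed by all of nat to keep ordinals out of the recursion. *)
Fixpoint kernel_integral
    (Q : forall k, R.-pker borel (prodX X k) ~> borel (X k)) (k : nat) :
    (prodX X k -> \bar R) -> \bar R :=
  match k with
  | 0%N => fun F => F point
  | k'.+1 => fun F => kernel_integral Q (kernel_step Q F)
  end.

Lemma restr_measurable j k (jk : (j <= k)%N) :
  measurable_fun setT (restr jk : borel (prodX X k) -> borel (prodX X j)).
Proof.
apply: (@continuous_borel_measurable (prodX X k) (prodX X j)).
exact: restr_continuous.
Qed.

Lemma measurable_rconsX k : (k < m)%N ->
  measurable_fun setT ((fun z => rconsX z.1 z.2) :
    borel (prodX X k) * borel (X k) -> borel (prodX X k.+1)).
Proof.
move=> km.
apply: (continuous2_borel_measurable (S := prodX X k) (T := X k)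
  (U := prodX X k.+1)); first exact: X_second_countable.
exact: rconsX_continuous.
Qed.

Variable Q : forall k, R.-pker borel (prodX X k) ~> borel (X k).

Lemma measurable_section k (km : (k < m)%N) (F : borel (prodX X k.+1) -> \bar R)
    (h : prodX X k) :
  measurable_fun setT F ->
  measurable_fun setT ((fun x => F (rconsX h x)) : borel (X k) -> \bar R).
Proof.
move=> mF.
refine (@measurableT_comp _ _ _ (borel (X k)) (borel (prodX X k.+1)) _ F setT
  (rconsX h) mF _).
exact: (@measurableT_comp _ _ _ _ (borel (prodX X k) * borel (X k))%type _
  (fun z => rconsX z.1 z.2 : borel (prodX X k.+1)) setT (pair h)
  (measurable_rconsX km) (pair1_measurable _)).
Qed.

Lemma measurable_kernel_step k (F : borel (prodX X k.+1) -> \bar R) :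
  (k < m)%N -> measurable_fun setT F -> (forall x, 0 <= F x) ->
  measurable_fun setT (kernel_step Q F : borel (prodX X k) -> \bar R).
Proof.
move=> km mF F0.
apply: (measurable_fun_integral_finite_kernel
  (fun z : borel (prodX X k) * borel (X k) => F (rconsX z.1 z.2)) (Q k)).
  by move=> z; exact: F0.
exact: measurableT_comp mF (measurable_rconsX km).
Qed.

Lemma kernel_step_ge0 k (F : prodX X k.+1 -> \bar R) (h : prodX X k) :
  (forall x, 0 <= F x) -> 0 <= kernel_step Q F h.
Proof. by move=> F0; apply: integral_ge0 => x _; exact: F0. Qed.

(** Condition on the first k coordinates to integrate out the coordinate of
    index k. *)
Lemma integral_restr (P : probability (borel (prodX X m)) R) k (km : (k <= m)%N)
    (F : borel (prodX X k) -> \bar R) :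
  (forall k (km : (k < m)%N), is_conditional_law P
     (restr (ltnW km) : _ -> borel (prodX X k))
     ((fun x : prodX X m => x (Ordinal km)) : _ -> borel (X k)) (Q k)) ->
  measurable_fun setT F -> (forall x, 0 <= F x) ->
  \int[P]_x F (restr km x) = kernel_integral Q F.
Proof.
move=> PQ; elim: k km F => [|k IH] km F mF F0 /=.
  transitivity (\int[P]_x cst (F point) x).
    apply: eq_integral => x _; congr (F _).
    by apply: functional_extensionality_dep; case.
  by rewrite integral_cst// [X in _ * X]probability_setT mule1.
rewrite -(IH (ltnW km)); last 2 first.
- exact: measurable_kernel_step.
- by move=> h; exact: kernel_step_ge0.
rewrite -(integral_conditional_law (T := borel (prodX X m))
  (T1 := borel (prodX X k)) (T2 := borel (X k)) (P := P)
  (F := fun z => F (rconsX z.1 z.2))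
  (Y := restr (ltnW km)) (Z := fun x : prodX X m => x (Ordinal km)) (Q := Q k))//.
- by apply: eq_integral => x _; rewrite rconsX_restr.
- exact: restr_measurable.
- refine (@continuous_borel_measurable (prodX X m) (X (Ordinal km)) _ _).
  exact: (@coord_continuous R X m (Ordinal km)).
- exact: measurableT_comp mF (measurable_rconsX km).
Qed.

(** In the integral over the last coordinate, the densities of the earlier
    ones are constants that factor out. All integrals are over sections in one
    coordinate, along which the densities are measurable. *)
Lemma iterated_integral_density
    (mu : forall k, {sigma_finite_measure set borel (X k) -> \bar R})
    (g : forall k, prodX X k -> X k -> R) k (F : borel (prodX X k) -> \bar R) :
  (forall k, (k < m)%N -> forall h, is_density (mu k) (Q k h) (g k h)) ->
  (k <= m)%N -> measurable_fun setT F -> (forall x, 0 <= F x) ->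
  iterated_integral mu (fun x : prodX X k =>
    F x * (\prod_(j < k) g j (past j x) (x j))%:E) = kernel_integral Q F.
Proof.
move=> Qg; elim: k F => [|k IH] F km mF F0 /=; first by rewrite big_ord0 mule1.
rewrite -(IH (kernel_step Q F)); last 3 first.
- exact: ltnW.
- exact: measurable_kernel_step.
- by move=> h; exact: kernel_step_ge0.
congr (iterated_integral mu _); apply/funext => h.
have [mg g0 gE] := Qg _ km h.
have prod0 : (0 <= \prod_(j < k) g j (past j h) (h j))%R.
  apply: prodr_ge0 => j _.
  by have [_ + _] := Qg _ (ltn_trans (ltn_ord j) km) (past j h); apply.
rewrite /kernel_step (integral_density (Qg _ km h))//; last first.
  exact: measurable_section.
rewrite -ge0_integralZr//; last 2 first.
- apply: emeasurable_funM; first exact: measurable_section.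
  exact/measurable_EFinP.
- by move=> x _; rewrite mule_ge0// lee_fin.
apply: eq_integral => x _; rewrite -muleA -EFinM; congr (_ * _%:E).
rewrite big_ord_recr mulrC; congr (_ * _)%R; last first.
  rewrite rconsX_ord_max; congr (g k _ x).
  rewrite -[LHS]/(restr _ _) -[RHS](restr_id (leqnn k)).
  exact: restr_rconsX.
apply: eq_bigr => j _.
rewrite (rconsX_lt h x (ltn_ord j : widen_ord _ j < k)%N).
rewrite (_ : h (Ordinal _) = h j); last first.
  exact: (@coord_val R X k h (Ordinal (ltn_ord j)) j erefl).
congr (g j _ (h j)).
exact: (restr_rconsX (ltnW (ltn_ord j))).
Qed.

End kernel_integrals.
(** * Comparison of two sequences of kernels *)

(** As 0 <= f2 <= 1, replacing g1 by g2 costs at most the L1 distance of the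
    densities. The two terms of the error are tracked additively so that the
    estimate can be iterated. *)
Lemma integral_density_le d (T : measurableType d) (R : realType)
    (mu nu1 nu2 : {measure set T -> \bar R}) (g1 g2 : T -> R)
    (f1 f2 : T -> \bar R) (a c : R) :
  nu1 setT = 1 ->
  is_density mu nu1 g1 -> is_density mu nu2 g2 ->
  \int[mu]_x `|g1 x - g2 x|%:E <= c%:E ->
  measurable_fun setT f1 -> measurable_fun setT f2 ->
  (forall x, 0 <= f1 x) -> (forall x, 0 <= f2 x <= 1) -> (0 <= a)%R ->
  (forall x, f1 x <= f2 x + a%:E) ->
  \int[nu1]_x f1 x <= \int[nu2]_x f2 x + (a + c)%:E.
Proof.
move=> nu11 d1 d2 gc mf1 mf2 f10 f201 a0 f12.
have [[mg1 g10 _] [mg2 g20 _]] := (d1, d2).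
have f20 x : 0 <= f2 x by have /andP[] := f201 x.
apply: (@le_trans _ _ (\int[nu1]_x (f2 x + a%:E))).
  apply: ge0_le_integral => //; first exact: emeasurable_funD.
rewrite ge0_integralD//.
rewrite integral_cst// nu11 mule1 EFinD addeA [leRHS]addeAC.
rewrite leeD2r// (integral_density d1)// (integral_density d2)//.
apply: (@le_trans _ _ (\int[mu]_x (f2 x * (g2 x)%:E + `|g1 x - g2 x|%:E))); last first.
  rewrite ge0_integralD//; first exact: leeD2l.
  - by move=> x _; rewrite mule_ge0// lee_fin.
  - by apply: emeasurable_funM => //; exact/measurable_EFinP.
  - apply/measurable_EFinP; apply: measurableT_comp => //; exact: measurable_funB.
apply: ge0_le_integral => //.
- by move=> x _; rewrite mule_ge0// lee_fin.
- by apply: emeasurable_funM => //; exact/measurable_EFinP.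
- apply: emeasurable_funD; first by apply: emeasurable_funM => //; exact/measurable_EFinP.
  by apply/measurable_EFinP; apply: measurableT_comp => //; exact: measurable_funB.
move=> x _; have := f201 x; case: (f2 x) => [r|/andP[]|/andP[]]//.
rewrite -!EFinM -EFinD !lee_fin => /andP[r0 r1].
rewrite -lerBlDl -mulrBr (le_trans (ler_norm _))// normrM ger0_norm//.
by rewrite ler_piMl.
Qed.

Section comparison.
Context {R : realType} {X : nat -> completeMetricType R}.
Variable m : nat.
Hypothesis X_second_countable :
  forall k, (k < m)%N -> second_countable (T := X k).
Variable mu : forall k, {measure set borel (X k) -> \bar R}.
Variables Q Q' : forall k, R.-pker borel (prodX X k) ~> borel (X k).
Variables p p' : forall k, prodX X k -> X k -> R.
Hypothesis Qp :
  forall k, (k < m)%N -> forall h, is_density (mu k) (Q k h) (p h).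
Hypothesis Qp' :
  forall k, (k < m)%N -> forall h, is_density (mu k) (Q' k h) (p' h).
Variables (B : forall k, set (prodX X k)) (c : R).
Hypothesis c0 : (0 <= c)%R.
Hypothesis Bc : forall k, (k < m)%N -> forall h, B h ->
  \int[mu k]_x `|p h x - p' h x|%:E <= c%:E.

(** Each replacement of a kernel costs c at the histories in B. Elsewhere F is
    zero at every continuation of the history, hence so is its integral over the
    next coordinate: the assumption on the support of F is inherited. *)
Lemma kernel_integral_le k (F F' : borel (prodX X k) -> \bar R) (a : R) :
  (k <= m)%N -> measurable_fun setT F -> measurable_fun setT F' ->
  (forall x, 0 <= F x) -> (forall x, 0 <= F' x <= 1) ->
  (forall x, F x != 0 -> forall j (jk : (j <= k)%N), (j < m)%N -> B (restr jk x)) ->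
  (0 <= a)%R -> (forall x, F x <= F' x + a%:E) ->
  kernel_integral Q F <= kernel_integral Q' F' + (a + c *+ k)%:E.
Proof.
elim: k F F' a => [|k IH] F F' a km mF mF' F0 F'01 FB a0 FF' /=.
  by rewrite mulr0n addr0; exact: FF'.
have F'0 x : 0 <= F' x by have /andP[] := F'01 x.
rewrite mulrS addrA; apply: IH.
- exact: ltnW.
- exact: (measurable_kernel_step (m := m)).
- exact: (measurable_kernel_step (m := m)).
- by move=> h; exact: kernel_step_ge0.
- move=> h; rewrite kernel_step_ge0//=.
  apply: (@le_trans _ _ (\int[Q' k h]_x cst 1 x)).
    apply: ge0_le_integral => //.
      exact: (measurable_section X_second_countable).
    by move=> x _; have /andP[] := F'01 (rconsX h x).
  by rewrite integral_cst// mul1e prob_kernel.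
- move=> h stepF0 j jk jm; apply: contrapT => nB; case/negP: stepF0.
  apply/eqP/integral0_eq => x _; apply: contrapT => /eqP Fx0; apply: nB.
  by rewrite -(restr_rconsX jk (leqW jk) h x); exact: FB.
- exact: addr_ge0.
move=> h.
have [hB|hB] := pselect (B h).
  apply: (integral_density_le _ (Qp km h) (Qp' km h)) => //.
  - exact: prob_kernel.
  - exact: Bc.
  - exact: (measurable_section X_second_countable).
  - exact: (measurable_section X_second_countable).
rewrite /kernel_step [X in X <= _]integral0_eq; last first.
  move=> x _; apply: contrapT => /eqP Fx0; apply: hB.
  by rewrite -(restr_id (leqnn k) h) -(restr_rconsX _ (leqnSn k) h x); exact: FB.
by rewrite adde_ge0// ?lee_fin ?addr_ge0//; exact: kernel_step_ge0.
Qed.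

(** Only the part of A inside G satisfies the support condition; the rest costs
    the mass outside G. *)
Lemma probability_kernel_integral_le (P P' : probability (borel (prodX X m)) R)
    (G A : set (borel (prodX X m))) :
  (forall A, measurable A -> P A = kernel_integral Q (EFin \o \1_A)) ->
  (forall A, measurable A -> P' A = kernel_integral Q' (EFin \o \1_A)) ->
  measurable G ->
  (forall x, G x -> forall j (jm : (j < m)%N), B (restr (ltnW jm) x)) ->
  measurable A -> P A <= P' A + (c *+ m)%:E + P (~` G).
Proof.
move=> PE P'E mG GB mA.
have mAG : measurable (A `&` G) by exact: measurableI.
apply: (@le_trans _ _ (P (A `&` G) + P (~` G))).
  have mAGc : measurable (A `&` ~` G) by apply: measurableI => //; exact: measurableC.
  rewrite -{1}(setIT A) -(setUv G) setIUr (le_trans (measureU2 _ _ _))//.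
  by rewrite leeD2l// le_measure// inE//; exact: measurableC.
rewrite leeD2r// (@le_trans _ _ (P' (A `&` G) + (c *+ m)%:E))//; last first.
  by rewrite leeD2r// le_measure ?inE.
rewrite PE// P'E// -[X in _ + X%:E]add0r; apply: kernel_integral_le => //.
- exact/measurable_EFinP.
- exact/measurable_EFinP.
- by move=> x; rewrite /= lee_fin.
- by move=> x; rewrite /= !lee_fin indicE; case: (_ \in _); rewrite ?ler01 ?lexx.
- move=> x; rewrite /= eqe pnatr_eq0 eqb0 negbK inE => -[_ Gx] j jk jm.
  have <- : ltnW jm = jk by exact: bool_irrelevance.
  exact: GB.
- by move=> x; rewrite adde0.
Qed.

End comparison.
(** * The distance of the two experiments for a fixed parameter *)

(** With D the mass of q, the distance of q and q / D is |1 - D|, which is the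
    difference of the masses of p and q and thus at most their L1 distance. *)
Lemma normalized_density_distance d (T : measurableType d) (R : realType)
    (mu : {measure set T -> \bar R}) (p q : T -> R) (D c : R) :
  measurable_fun setT p -> measurable_fun setT q ->
  (forall x, 0 <= p x)%R -> (forall x, 0 <= q x)%R -> (0 < D)%R ->
  \int[mu]_x (p x)%:E = 1 -> \int[mu]_x (q x)%:E = D%:E ->
  \int[mu]_x `|p x - q x|%:E <= c%:E ->
  \int[mu]_x `|p x - q x / D|%:E <= (c + c)%:E.
Proof.
move=> mp mq p0 q0 D0 ip iq pqc.
have mpE : measurable_fun setT (EFin \o p) by exact/measurable_EFinP.
have mqE : measurable_fun setT (EFin \o q) by exact/measurable_EFinP.
have mpq : measurable_fun setT (fun x => `|p x - q x|%:E).
  by apply/measurable_EFinP; apply: measurableT_comp => //; exact: measurable_funB.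
have Dc : (D <= 1 + c)%R.
  rewrite -lee_fin -iq EFinD -ip (le_trans _ (leeD2l _ pqc))//.
  rewrite -ge0_integralD//; last by move=> x _; rewrite lee_fin.
  apply: ge0_le_integral => //.
  - by move=> x _; rewrite lee_fin.
  - exact: emeasurable_funD.
  - move=> x _; rewrite -EFinD lee_fin -lerBlDl distrC.
    exact: ler_norm.
have cD : (1 <= D + c)%R.
  rewrite -lee_fin -[leLHS]ip EFinD -iq (le_trans _ (leeD2l _ pqc))//.
  rewrite -ge0_integralD//; last by move=> x _; rewrite lee_fin.
  apply: ge0_le_integral => //.
  - by move=> x _; rewrite lee_fin.
  - exact: emeasurable_funD.
  - by move=> x _; rewrite -EFinD lee_fin -lerBlDl; exact: ler_norm.
have Dn0 : D != 0%R by rewrite gt_eqF.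
pose s := `|1 - D^-1|%R.
have s0 : (0 <= s)%R by exact: normr_ge0.
have sD : (D * s <= c)%R.
  rewrite /s -{1}[D]gtr0_norm// -normrM mulrBr mulr1 divff//.
  by rewrite ler_norml; apply/andP; split; lra.
apply: (@le_trans _ _ (\int[mu]_x (`|p x - q x|%:E + (q x)%:E * s%:E))).
  apply: ge0_le_integral => //.
  - apply/measurable_EFinP; apply: measurableT_comp => //.
    by apply: measurable_funB => //; exact: measurable_funM.
  - by apply: emeasurable_funD => //; exact: emeasurable_funM.
  move=> x _; rewrite -EFinM -EFinD lee_fin.
  rewrite -[X in (_ + X * _)%R]ger0_norm// -normrM.
  apply: le_trans (ler_normD _ _); rewrite le_eqVlt; apply/orP; left; apply/eqP.
  by congr (Num.norm _); rewrite mulrBr mulr1 addrA subrK.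
rewrite ge0_integralD//; last 2 first.
- by move=> x _; rewrite mule_ge0// lee_fin.
- exact: emeasurable_funM.
rewrite ge0_integralZr//; last by move=> x _; rewrite lee_fin.
by rewrite iq -EFinM [leRHS]EFinD leeD// lee_fin.
Qed.

(** The probability P0 is the fallback of [knormalize] at points where the mass
    is zero or infinite. *)
Lemma normalized_kernel_density d1 d2 (T1 : measurableType d1)
    (T2 : measurableType d2) (R : realType) (mu : {measure set T2 -> \bar R})
    (k : R.-ker T1 ~> T2) (P0 : probability T2 R) (q : T1 -> T2 -> R) (y : T1) :
  is_density mu (k y) (q y) -> \int[mu]_x (q y x)%:E != 0 ->
  \int[mu]_x (q y x)%:E < +oo ->
  is_density mu (knormalize k P0 y)
    (fun x => q y x / fine (\int[mu]_x (q y x)%:E))%R.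
Proof.
move=> [mq q0 kE] I0 Ioo.
have D0 : (0 <= fine (\int[mu]_x (q y x)%:E))%R.
  by rewrite fine_ge0// integral_ge0// => x _; rewrite lee_fin.
split.
- exact: measurable_funM.
- by move=> x; rewrite divr_ge0.
have kT : k y setT = \int[mu]_x (q y x)%:E by rewrite kE.
move=> A mA; rewrite /knormalize/= /mnormalize kT (negbTE I0) (lt_eqF Ioo)/= kE//.
rewrite -ge0_integralZr//.
- by apply/measurable_EFinP; exact: measurable_funTS.
- by move=> x _; rewrite lee_fin.
- by rewrite lee_fin invr_ge0.
Qed.
Section fixed_experiment.
Context {R : realType} {X : nat -> completeMetricType R} (m : nat).
Hypothesis X_separable : forall j : 'I_m, separable (X j).
Variable mu : forall j, {sigma_finite_measure set borel (X j) -> \bar R}.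
Variables P Pt : probability (borel (prodX X m)) R.
Variables p pt : forall j : 'I_m, prodX X j -> X j -> R.
Hypothesis P_density : forall j : 'I_m,
  exists Q : R.-pker borel (prodX X j) ~> borel (X j),
    [/\ is_conditional_law (T1 := borel (prodX X j)) (T2 := borel (X j))
          P (past j) (fun x => x j) Q,
        forall y, Q y `<< mu j & forall y, is_density (mu j) (Q y) (p y)].
Hypothesis pt_kernel : forall j : 'I_m,
  exists k : R.-ker borel (prodX X j) ~> borel (X j),
    forall y, is_density (mu j) (k y) (pt y).
Hypothesis pt_mass : forall (j : 'I_m) (y : prodX X j),
  \int[mu j]_x (pt y x)%:E != 0 /\ \int[mu j]_x (pt y x)%:E < +oo.
Hypothesis PtE : forall A : set (borel (prodX X m)), measurable A ->
  Pt A = iterated_integral mu (fun x : prodX X m =>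
    (\1_A x * normalized_product mu pt x)%:E).
Variable K : 'I_m -> set (borel (prodX X m)).
Hypothesis K_past : forall j : 'I_m, (0 < j)%N ->
  g_sigma_algebra_preimage (past j : _ -> borel (prodX X j)) (K j).
Variables e c : R.
Hypothesis c0 : (0 <= c)%R.

Let Kc := \bigcup_(j in [set j : 'I_m | (0 < j)%N]) ~` K j.
Hypothesis PK : P Kc <= e%:E.
Hypothesis PtK : Pt Kc <= e%:E.
Hypothesis pc : forall (j : 'I_m) (y : prodX X j),
  ((0 < j)%N -> (past j @` K j) y) -> \int[mu j]_x `|p y x - pt y x|%:E <= c%:E.

Let pastE k (km : (k < m)%N) (x : prodX X m) :
  past (Ordinal km) x = restr (ltnW km) x.
Proof.
by apply: functional_extensionality_dep => i;
  exact: (@coord_val R X m x (widen_ord (ltnW (ltn_ord (Ordinal km))) i)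
    (widen_ord (ltnW km) i) erefl).
Qed.

Let X_second_countable k : (k < m)%N -> second_countable (T := X k).
Proof.
by move=> km; apply: separable_second_countable; exact: X_separable (Ordinal km).
Qed.

Let measurable_past (j : 'I_m) :
  measurable_fun setT (past j : borel (prodX X m) -> borel (prodX X j)).
Proof. exact: (restr_measurable (ltnW (ltn_ord j))). Qed.

Let measurable_Kc : measurable Kc.
Proof.
apply: fin_bigcup_measurable => [|j j0]; first exact: finite_finset.
have [B mB <-] := K_past j0; apply: measurableC.
exact: measurable_past.
Qed.

Lemma probability_difference_le (A : set (borel (prodX X m))) : measurable A ->
  P A <= Pt A + ((c + c) *+ m + e)%:E /\ Pt A <= P A + ((c + c) *+ m + e)%:E.
Proof.
move=> mA.
(* Total families of kernels and densities: kernel and density for P and for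
   Pt, with arbitrary values at indices that exceed m. *)
have total j : exists W :
    ((R.-pker borel (prodX X j) ~> borel (X j)) *
     (R.-pker borel (prodX X j) ~> borel (X j))) *
    ((prodX X j -> X j -> R) * (prodX X j -> X j -> R)),
  forall jm : (j < m)%N,
  [/\ is_conditional_law (T1 := borel (prodX X j)) (T2 := borel (X j))
          P (restr (ltnW jm)) (fun x => x (Ordinal jm)) W.1.1,
      W.2.1 = p (j := Ordinal jm),
      W.2.2 = (fun y x => pt (j := Ordinal jm) y x /
                fine (\int[mu j]_t (pt (j := Ordinal jm) y t)%:E))%R,
      forall y, is_density (mu j) (W.1.1 y) (W.2.1 y) &
      forall y, is_density (mu j) (W.1.2 y) (W.2.2 y)].
  pose P0 : probability (borel (X j)) R := \d_(point : borel (X j)).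
  have [jm|mj] := pselect (j < m)%N; last first.
    pose dQ : R.-pker borel (prodX X j) ~> borel (X j) :=
      kdirac (measurable_cst (point : borel (X j))).
    exists ((dQ, dQ), ((fun _ _ => 0%R), (fun _ _ => 0%R))) => jm.
    by case: mj.
  have [Q [PQ _ Qp]] := P_density (Ordinal jm).
  have [k kpt] := pt_kernel (Ordinal jm).
  pose Q' : R.-pker borel (prodX X j) ~> borel (X j) := knormalize k P0.
  exists ((Q, Q'), (p (j := Ordinal jm),
    (fun y x => pt (j := Ordinal jm) y x /
                fine (\int[mu j]_t (pt (j := Ordinal jm) y t)%:E))%R)) => jm'.
  rewrite (bool_irrelevance jm' jm); split => //.
  - have <- : ltnW (ltn_ord (Ordinal jm)) = ltnW jm by exact: bool_irrelevance.
    exact: PQ.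
  - move=> y; have [I0 Ioo] := @pt_mass (Ordinal jm) y.
    exact: normalized_kernel_density.
pose W j := projT1 (cid (total j)).
have WP j jm := projT2 (cid (total j)) jm.
pose Q j := (W j).1.1; pose Q' j := (W j).1.2.
pose q j := (W j).2.1; pose q' j := (W j).2.2.
have Qq k : (k < m)%N -> forall h, is_density (mu k) (Q k h) (q k h).
  by move=> km; have [_ _ _ + _] := WP k km.
have Qq' k : (k < m)%N -> forall h, is_density (mu k) (Q' k h) (q' k h).
  by move=> km; have [_ _ _ _ +] := WP k km.
have PE A' : measurable A' -> P A' = kernel_integral Q (EFin \o \1_A').
  move=> mA'; rewrite -(integral_restr X_second_countable (leqnn m) (P := P))//.
  - under eq_integral do rewrite restr_id.
    by rewrite integral_indic// setIT.
  - by move=> k km; have [+ _ _ _ _] := WP k km.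
  - exact/measurable_EFinP.
  - by move=> x; rewrite lee_fin.
have PtE' A' : measurable A' -> Pt A' = kernel_integral Q' (EFin \o \1_A').
  move=> mA'; rewrite PtE// -(iterated_integral_density X_second_countable Qq')//;
    last 2 first.
  - exact/measurable_EFinP.
  - by move=> x; rewrite lee_fin.
  congr (iterated_integral mu _); apply/funext => x; rewrite EFinM; congr (_ * _%:E).
  apply: eq_bigr => -[j jm] _; have [_ _ + _ _] := WP j jm.
  by rewrite -/(q' j) => ->.
(* The image of K j as it occurs in the hypothesis; no condition for j = 0. *)
pose B j : set (prodX X j) :=
  [set y : prodX X j | forall jm : (j < m)%N, (0 < j)%N ->
    (past (Ordinal jm) @` K (Ordinal jm)) y].
have Bc k : (k < m)%N -> forall h, B k h ->
    \int[mu k]_x `|q k h x - q' k h x|%:E <= (c + c)%:E.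
  move=> km h hB; have [_ qE q'E Wd _] := WP k km.
  have [k' kpt] := pt_kernel (Ordinal km).
  have [I0 Ioo] := @pt_mass (Ordinal km) h.
  have [mpt pt0 _] := kpt h; have [mq q0 QE] := Wd h.
  rewrite /q' q'E; apply: normalized_density_distance => //.
  - rewrite fine_gt0// Ioo andbT lt_def I0 integral_ge0// => x _.
    by rewrite lee_fin.
  - by rewrite -QE// prob_kernel.
  - by rewrite fineK// ge0_fin_numE// integral_ge0// => x _; rewrite lee_fin.
  - by rewrite /q qE; exact: (@pc (Ordinal km) h (hB km)).
have cc0 : (0 <= c + c)%R by exact: addr_ge0.
have mG : measurable (~` Kc) by exact: measurableC.
have GB x : (~` Kc) x -> forall j (jm : (j < m)%N), B j (restr (ltnW jm) x).
  move=> nK j jm jm' j0; exists x; last first.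
    by rewrite pastE; congr (restr _ x); exact: bool_irrelevance.
  by apply: contrapT => nKx; apply: nK; exists (Ordinal jm').
have B'c k : (k < m)%N -> forall h, B k h ->
    \int[mu k]_x `|q' k h x - q k h x|%:E <= (c + c)%:E.
  by move=> km h hB; under eq_integral do rewrite distrC; exact: Bc.
split; rewrite EFinD addeA.
- apply: le_trans (probability_kernel_integral_le X_second_countable Qq Qq' cc0
    Bc PE PtE' mG GB mA) _.
  by rewrite setCK leeD2l.
- apply: le_trans (probability_kernel_integral_le X_second_countable Qq' Qq cc0
    B'c PtE' PE mG GB mA) _.
  by rewrite setCK leeD2l.
Qed.

End fixed_experiment.
(** * Total variation *)

Section total_variation.
Context d (T : measurableType d) (R : realType).
Variables (P Q : probability T R) (t : R).

Let charge_subE A : measurable A -> charge_sub P Q A = P A - Q A.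
Proof. by move=> mA; rewrite /charge_sub /cadd/= /copp/=. Qed.

Lemma tv_norm_ge0 : 0 <= tv_norm (charge_sub P Q).
Proof. by rewrite /tv_norm /charge_variation/=; apply: adde_ge0; exact: measure_ge0. Qed.

Hypothesis PQ : forall A, measurable A -> P A <= Q A + t%:E.

Let sub_le A : measurable A -> charge_sub P Q A <= t%:E.
Proof.
by move=> mA; rewrite charge_subE// leeBlDl ?fin_num_measure//; exact: PQ.
Qed.

(** By the Jordan decomposition of P - Q, the measure P is at most Q plus a
    measure of total mass at most t. *)
Lemma integral_le_add_bound (f : T -> \bar R) (M : R) :
  measurable_fun setT f -> (forall x, 0 <= f x <= M%:E) -> (0 <= M)%R ->
  \int[P]_x f x <= \int[Q]_x f x + (M * t)%:E.
Proof.
move=> mf fM M0.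
have f0 x : 0 <= f x by have /andP[] := fM x.
have [D [N DN]] := Hahn_decomposition (charge_sub P Q).
have mD : measurable D by have [[]] := DN.
pose jp : {measure set T -> \bar R} := jordan_pos DN.
pose jn : {measure set T -> \bar R} := jordan_neg DN.
have jpT : jp setT <= t%:E.
  by rewrite [jp _]jordan_posE cjordan_posE /crestr0 mem_set//= /crestr setTI; exact: sub_le.
have add_eq A : measurable A -> A `<=` setT -> measure_add P jn A = measure_add Q jp A.
  move=> mA _; suff : P A + jn A = Q A + jp A by rewrite !measure_addE.
  have : P A - Q A = jp A - jn A.
    rewrite -charge_subE// [LHS](jordan_decomp DN mA).
    by rewrite [LHS]/cadd/= cscaleN1.
  have : P A \is a fin_num by exact: fin_num_measure.
  have : Q A \is a fin_num by exact: fin_num_measure.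
  have : jp A \is a fin_num by exact: fin_num_measure.
  have : jn A \is a fin_num by exact: fin_num_measure.
  case: (P A) (Q A) (jp A) (jn A) => [a| |]// [b| |]// [u| |]// [v| |]// _ _ _ _.
  by rewrite -!EFinB -!EFinD => -[?]; congr _%:E; lra.
have jnf : 0 <= \int[jn]_x f x by exact: integral_ge0.
apply: (@le_trans _ _ (\int[P]_x f x + \int[jn]_x f x)); first by rewrite leeDl.
rewrite -ge0_integral_measure_add// (eq_measure_integral _ add_eq).
rewrite ge0_integral_measure_add// leeD2l//.
apply: (@le_trans _ _ (\int[jp]_x cst M%:E x)).
  by apply: ge0_le_integral => // x _; have /andP[] := fM x.
by rewrite integral_cst// EFinM; apply: lee_wpmul2l; rewrite ?lee_fin.
Qed.

Hypothesis QP : forall A, measurable A -> Q A <= P A + t%:E.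

Lemma tv_norm_le : tv_norm (charge_sub P Q) <= (t + t)%:E.
Proof.
suff : forall D N (DN : hahn_decomposition (charge_sub P Q) D N),
  charge_variation DN setT <= (t + t)%:E by exact.
move=> D N DN.
have mD : measurable D by have [[]] := DN.
have mN : measurable N by have [_ []] := DN.
rewrite /charge_variation/= EFinD; apply: leeD.
  rewrite jordan_posE cjordan_posE /crestr0 mem_set//= /crestr setTI.
  exact: sub_le.
rewrite jordan_negE cjordan_negE /crestr0 mem_set//= /crestr setTI.
rewrite [X in - X](charge_subE mN) oppeB ?fin_num_adde_defr ?fin_num_measure// addeC.
by rewrite leeBlDl ?fin_num_measure//; exact: QP.
Qed.

End total_variation.
(** * Likelihood ratios *)

Section logarithm.
Context {R : realType}.

Lemma le_lne_expR (r : R) (x : \bar R) : (r%:E <= lne x) = ((expR r)%:E <= x).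
Proof.
case: x => [s| |]/=; rewrite ?leey ?leeNy_eq//.
case: ifPn => [s0|]; first by rewrite leeNy_eq lee_fin leNgt (le_lt_trans s0)// expR_gt0.
by rewrite -ltNge => s0; rewrite !lee_fin -[in RHS](lnK (s0 : s \is Num.pos)) ler_expR.
Qed.

Lemma measurable_lne : measurable_fun setT (@lne R).
Proof.
apply: (measurability _ (ErealGenCInfty.measurableE R)) => _ /= -[_ [r ->] <-].
rewrite setTI (_ : _ @^-1` _ = [set x | (expR r)%:E <= x]).
  rewrite -[X in measurable X]setTI.
  by apply: emeasurable_fun_c_infty.
by apply/seteqP; split=> x; rewrite /= in_itv/= andbT le_lne_expR.
Qed.

(** Since l is positive and finite, the difference is never of the form oo - oo;
    the values 0 and +oo of x fall under the second and the first case. *)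
Lemma lne_deviation (e l : R) (x : \bar R) : (0 < l)%R -> 0 <= x ->
  e%:E <= `|lne x - lne l%:E| ->
  (expR e * l)%:E <= x \/ (expR e)%:E * x <= l%:E.
Proof.
move=> l0; rewrite lne_EFin//; case: x => [s| |]//; last by left; rewrite leey.
rewrite lee_fin le_eqVlt => /predU1P[<- _|s0]; first by right; rewrite mule0 lee_fin ltW.
rewrite lne_EFin// -EFinB/= -EFinM !lee_fin.
rewrite -{2 3}(lnK (s0 : s \is Num.pos)) -{2 3}(lnK (l0 : l \is Num.pos)) -!expRD !ler_expR.
by rewrite ler_normr => /orP[?|?]; [left|right]; lra.
Qed.

End logarithm.

Section likelihood_ratio.
Context d (T : measurableType d) (R : realType).

(** Off the null set that carries the singular part, the derivative is an
    ordinary density. *)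
Lemma ac_derivative_off_null (Q P : probability T R) (f : T -> \bar R) :
  is_ac_derivative Q P f ->
  exists N, [/\ measurable N, P N = 0 &
    forall A, measurable A -> A `<=` ~` N -> Q A = \int[P]_(x in A) f x].
Proof.
move=> [mf f0 [Qa [Qs [QE _ [N [mN PN QsN]] QaE]]]].
exists N; split => // A mA AN; rewrite QE// QaE//.
rewrite (_ : Qs A = 0) ?adde0//; apply/eqP; rewrite eq_le measure_ge0 andbT.
by rewrite -QsN le_measure// inE//; exact: measurableC.
Qed.

Lemma ac_derivative_integral_le1 (Q P : probability T R) (f : T -> \bar R) :
  is_ac_derivative Q P f -> \int[P]_x f x <= 1.
Proof.
move=> [mf f0 [Qa [Qs [QE _ _ QaE]]]].
by rewrite -QaE// -(probability_setT Q) QE// leeDl.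
Qed.

Variables P0 P1 Q0 Q1 : probability T R.
Variables (L Lt : T -> \bar R) (t dl M r : R).
Hypothesis L_ac : is_ac_derivative P1 P0 L.
Hypothesis Lt_ac : is_ac_derivative Q1 Q0 Lt.
Hypotheses (t0 : (0 <= t)%R) (dl0 : (0 < dl)%R) (M0 : (0 < M)%R) (r1 : (1 < r)%R).
Hypothesis PQ0 : forall A, measurable A -> P0 A <= Q0 A + t%:E.
Hypothesis QP0 : forall A, measurable A -> Q0 A <= P0 A + t%:E.
Hypothesis PQ1 : forall A, measurable A -> P1 A <= Q1 A + t%:E.
Hypothesis QP1 : forall A, measurable A -> Q1 A <= P1 A + t%:E.

(** Chosen to cover both cases of [ratio_set_le], whose direct bounds are
    t (1 + r M) / ((r - 1) dl) and t (r + M) / ((r - 1) dl). *)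
Let C := (r * (1 + M) / ((r - 1) * dl))%R.

(** If L exceeds Lt by the factor r on A, compare
    r int_A Lt dP0 <= P1 A <= Q1 A + t = int_A Lt dQ0 + t,
    and move from P0 to Q0 at the cost M t; if it falls short by that factor, use
    Q1 A <= P1 A + t instead. *)
Lemma ratio_set_le (A : set T) : measurable A ->
  P1 A = \int[P0]_(x in A) L x -> Q1 A = \int[Q0]_(x in A) Lt x ->
  (forall x, A x -> dl%:E <= Lt x <= M%:E) ->
  (forall x, A x -> r%:E * Lt x <= L x) \/ (forall x, A x -> r%:E * L x <= Lt x) ->
  Q0 A <= (t * C)%:E.
Proof.
move=> mA P1A Q1A AdM ratio.
have [mL L0 _] := L_ac; have [mLt Lt0 _] := Lt_ac.
have mLA : measurable_fun A L by exact: measurable_funTS.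
have mLtA : measurable_fun A Lt by exact: measurable_funTS.
have r0 : (0 < r)%R by exact: lt_trans r1.
pose I := \int[Q0]_(x in A) Lt x; pose I' := \int[P0]_(x in A) Lt x.
have bound x : 0 <= (Lt \_ A) x <= M%:E.
  rewrite patchE; case: ifPn => [|_]; last by rewrite lexx lee_fin ltW.
  by rewrite inE => /AdM /andP[_ ->]; rewrite Lt0.
have mpatch : measurable_fun setT (Lt \_ A) by apply: ((measurable_restrictT _ mA).1).
have II' : I <= I' + (M * t)%:E.
  by rewrite /I /I' [leLHS]integral_mkcond [X in _ <= X + _]integral_mkcond;
    apply: (integral_le_add_bound QP0) => //; exact: ltW.
have I'I : I' <= I + (M * t)%:E.
  by rewrite /I /I' [leLHS]integral_mkcond [X in _ <= X + _]integral_mkcond;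
    apply: (integral_le_add_bound PQ0) => //; exact: ltW.
have dlI : dl%:E * Q0 A <= I.
  rewrite -integral_cst//; apply: ge0_le_integral => //.
  - by move=> x _; rewrite lee_fin ltW.
  - by move=> x /AdM /andP[].
have Q0fin : Q0 A \is a fin_num by exact: fin_num_measure.
have Ifin : I \is a fin_num by rewrite /I -Q1A fin_num_measure.
have I'fin : I' \is a fin_num.
  rewrite ge0_fin_numE; last exact: integral_ge0.
  by rewrite (le_lt_trans I'I)// -(fineK Ifin) -EFinD ltry.
have P1fin : P1 A \is a fin_num by exact: fin_num_measure.
have QP := QP1 mA; have PQ := PQ1 mA; rewrite -/I in Q1A.
have key : r%:E * I' <= P1 A \/ r%:E * P1 A <= I'.
  case: ratio => ratio; [left|right]; rewrite P1A -ge0_integralZl// ?lee_fin ?(ltW r0)//.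
  - apply: ge0_le_integral => //.
    + by move=> x _; rewrite mule_ge0// lee_fin ltW.
    + exact: measurable_funeM.
  - apply: ge0_le_integral => //.
    + by move=> x _; rewrite mule_ge0// lee_fin ltW.
    + exact: measurable_funeM.
rewrite Q1A in QP PQ.
move: Q0fin Ifin I'fin P1fin II' I'I dlI QP PQ key; rewrite -/I -/I'.
case: (Q0 A) (I) (I') (P1 A) => [q| |]// [i| |]// [i'| |]// [p| |]// _ _ _ _.
rewrite -!EFinM -!EFinD !lee_fin => II' I'I dlI QP PQ key.
rewrite /C mulrA ler_pdivlMr ?mulr_gt0 ?subr_gt0//.
have dq : ((r - 1) * (dl * q) <= (r - 1) * i)%R by rewrite ler_wpM2l// subr_ge0 ltW.
have Mt : (0 <= M * t)%R by rewrite mulr_ge0// ltW.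
have rt : (0 <= (r - 1) * t)%R by rewrite mulr_ge0// subr_ge0 ltW.
have rMt : (0 <= (r - 1) * (M * t))%R by rewrite mulr_ge0// subr_ge0 ltW.
case: key => key.
  have : (r * i <= r * (i' + M * t))%R by rewrite ler_wpM2l// ltW.
  by lra.
have : (r * i <= r * (p + t))%R by rewrite ler_wpM2l// ltW.
by lra.
Qed.

Lemma log_ratio_measurable (e : R) :
  measurable [set x | e%:E <= `|lne (L x) - lne (Lt x)|].
Proof.
have [mL _ _] := L_ac; have [mLt _ _] := Lt_ac.
rewrite -[X in measurable X]setTI; apply: emeasurable_fun_c_infty => //.
apply: measurableT_comp => //.
by apply: emeasurable_funB; apply: measurableT_comp => //; exact: measurable_lne.
Qed.

(** Off the tails of Lt and the two null sets, a deviation of the logarithms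
    puts x in one of the two sets of [ratio_set_le]. The null set N of P0 has
    Q0-mass at most t. *)
Lemma log_ratio_deviation_le (e : R) : r = expR e ->
  Q0 [set x | e%:E <= `|lne (L x) - lne (Lt x)|] <=
  Q0 [set x | Lt x < dl%:E] + (M^-1 + t + (t * C + t * C))%:E.
Proof.
move=> re.
have [mL L0 _] := L_ac; have [mLt Lt0 _] := Lt_ac.
have [N [mN PN NE]] := ac_derivative_off_null L_ac.
have [Nt [mNt QNt NtE]] := ac_derivative_off_null Lt_ac.
pose lo := [set x | Lt x < dl%:E]; pose hi := [set x | M%:E <= Lt x].
have mlo : measurable lo.
  by rewrite -[lo]setTI; exact: emeasurable_fun_infty_o.
have mhi : measurable hi.
  by rewrite -[hi]setTI; exact: emeasurable_fun_c_infty.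
pose G := ~` (lo `|` hi `|` (N `|` Nt)).
have mG : measurable G by apply: measurableC; do 2?apply: measurableU.
pose A := G `&` [set x | r%:E * Lt x <= L x].
pose B := G `&` [set x | r%:E * L x <= Lt x].
have mA : measurable A.
  by apply: measurable_lee => //; apply: measurable_funTS => //; exact: measurable_funeM.
have mB : measurable B.
  by apply: measurable_lee => //; apply: measurable_funTS => //; exact: measurable_funeM.
have GNN x : G x -> (~` N) x /\ (~` Nt) x.
  by move=> nG; split=> ?; apply: nG; right; [left|right].
have GdM x : G x -> dl%:E <= Lt x <= M%:E.
  move=> nG; apply/andP; split; rewrite leNgt; apply/negP => H; apply: nG; left.
    by left.
  by right; exact: ltW.
have QA : Q0 A <= (t * C)%:E.
  apply: ratio_set_le => //; last by left => x [].
  - by apply: NE => // x [/GNN[]].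
  - by apply: NtE => // x [/GNN[]].
  - by move=> x [/GdM].
have QB : Q0 B <= (t * C)%:E.
  apply: ratio_set_le => //; last by right => x [].
  - by apply: NE => // x [/GNN[]].
  - by apply: NtE => // x [/GNN[]].
  - by move=> x [/GdM].
have Qhi : Q0 hi <= (M^-1)%:E.
  have : M%:E * Q0 hi <= 1.
    apply: le_trans (ac_derivative_integral_le1 Lt_ac).
    rewrite -integral_cst//; apply: (@le_trans _ _ (\int[Q0]_(x in hi) Lt x)).
      apply: ge0_le_integral => //; first by move=> x _; rewrite lee_fin ltW.
      exact: measurable_funTS.
    exact: ge0_subset_integral.
  have : Q0 hi \is a fin_num by exact: fin_num_measure.
  case: (Q0 hi) => [q| |]// _; rewrite -EFinM !lee_fin => Mq.
  by rewrite -(ler_pM2l M0) divff ?gt_eqF.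
have QN : Q0 (N `|` Nt) <= t%:E.
  rewrite (le_trans (measureU2 _ _ _))// [X in _ + X](_ : _ = 0)// adde0.
  by rewrite (le_trans (QP0 mN))// PN add0e.
apply: (@le_trans _ _ (Q0 (lo `|` hi `|` (N `|` Nt) `|` (A `|` B)))).
  rewrite le_measure ?inE//.
  - exact: log_ratio_measurable.
  - by do ?apply: measurableU.
  move=> x xe.
  have [Gx|nGx] := pselect (G x); last by left; exact: contrapT.
  right; have /andP[] := GdM x Gx; move: xe.
  rewrite /A /B /=; have := Lt0 x; case: (Lt x) => [l| |]//= l0 xe dll lM.
  have l_gt0 : (0 < l)%R by rewrite (lt_le_trans dl0).
  have [?|?] := lne_deviation l_gt0 (L0 x) xe; [left|right]; split => //.
    by rewrite /= re.
  by rewrite /= re.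
have mS : measurable (lo `|` hi `|` (N `|` Nt)) by do ?apply: measurableU.
rewrite (le_trans (measureU2 _ _ _))//; first exact: measurableU.
rewrite 2!EFinD addeA leeD//; last first.
  by rewrite (le_trans (measureU2 _ _ _))// EFinD leeD.
rewrite (le_trans (measureU2 _ _ _))//; do ?exact: measurableU.
rewrite addeA leeD// (le_trans (measureU2 _ _ _))// leeD2l//.
Qed.

End likelihood_ratio.
(** * Limits *)

Section operator_norm.
Context {R : realType} (d : nat).
Implicit Types (A : 'M[R]_d) (v : 'cV[R]_d).

Lemma entry_le_euclid_norm v i : (`|v i ord0| <= euclid_norm v)%R.
Proof.
rewrite -sqrtr_sqr ler_wsqrtr// (bigD1 i)//= lerDl.
by apply: sumr_ge0 => j _; exact: sqr_ge0.
Qed.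

(** The supremum that defines [op_norm] is over a bounded set: the Frobenius
    type bound with row sums is an upper bound. *)
Lemma euclid_norm_mulmx_le_op_norm A v :
  (euclid_norm v <= 1)%R -> (euclid_norm (A *m v) <= op_norm A)%R.
Proof.
move=> v1; apply: ub_le_sup; last by exists v.
exists (Num.sqrt (\sum_(i < d) (\sum_(j < d) `|A i j|) ^+ 2))%R => _ [w w1 <-].
rewrite ler_wsqrtr// ler_sum// => i _; rewrite mxE -[leLHS]real_normK ?num_real//.
rewrite ler_pXn2r ?nnegrE//.
  rewrite (le_trans (ler_norm_sum _ _ _))// ler_sum// => j _.
  by rewrite normrM ler_piMr// (le_trans (entry_le_euclid_norm w j)).
by apply: sumr_ge0.
Qed.

Lemma mulmx_near_translate (Theta : set 'cV[R]_d) (a h : 'cV[R]_d)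
    (eps : nat -> 'M[R]_d) :
  open Theta -> Theta a -> op_norm (eps n) @[n --> \oo] --> (0 : R)%R ->
  \forall n \near \oo, Theta (a + eps n *m h)%R.
Proof.
move=> Theta_open Thetaa eps0.
have /nbhs_ballP[r /= r0 rTheta] : nbhs a Theta by exact: open_nbhs_nbhs.
have n0 : (0 <= euclid_norm h)%R by exact: sqrtr_ge0.
pose s := (1 + euclid_norm h)%R.
have s0 : (0 < s)%R by rewrite ltr_pwDl.
have /cvgrPdist_lt/(_ (r / s)%R) := eps0.
rewrite divr_gt0// => /(_ isT); apply: filterS => n.
rewrite sub0r normrN => opn; apply: rTheta; split=> // i j.
rewrite (ord1 j) /ball/= !mxE opprD addrA subrr sub0r normrN.
have -> : (\sum_j eps n i j * h j ord0 = (eps n *m h) i ord0)%R by rewrite mxE.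
have -> : (eps n *m h = s *: (eps n *m (s^-1 *: h)))%R.
  by rewrite -scalemxAr scalerA divff ?scale1r// gt_eqF.
rewrite mxE normrM gtr0_norm// -ltr_pdivlMl// mulrC.
apply: le_lt_trans opn; apply: le_trans (ler_norm _).
apply: le_trans (entry_le_euclid_norm _ _) _.
apply: euclid_norm_mulmx_le_op_norm.
rewrite /euclid_norm (eq_bigr (fun i => s^-1 ^+ 2 * h i ord0 ^+ 2))%R; last first.
  by move=> k _; rewrite mxE exprMn.
rewrite -mulr_sumr sqrtrM ?sqr_ge0// sqrtr_sqr gtr0_norm ?invr_gt0//.
by rewrite -/(euclid_norm h) mulrC ler_pdivrMr// mul1r lerDr.
Qed.

End operator_norm.

Lemma cvg0_ereal (R : realType) (u : nat -> \bar R) : (forall n, 0 <= u n) ->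
  (forall e : R, (0 < e)%R -> \forall n \near \oo, u n <= e%:E) ->
  u n @[n --> \oo] --> 0.
Proof.
move=> u0 ue; apply/fine_cvgP; split.
  apply: filterS (ue 1%R ltr01) => n un.
  by rewrite ge0_fin_numE// (le_lt_trans un)// ltry.
apply/cvgrPdist_le => e e0; apply: filterS (ue e e0) => n un.
have ufin : u n \is a fin_num by rewrite ge0_fin_numE// (le_lt_trans un)// ltry.
by rewrite sub0r normrN /= ger0_norm ?fine_ge0// -lee_fin fineK.
Qed.

Lemma near_lt_limn_esup (R : realType) (u : nat -> \bar R) (e : \bar R) :
  limn_esup u < e -> \forall n \near \oo, u n < e.
Proof.
move=> /ereal_inf_lt[_ [V Voo <-] Ve].
apply: filterS Voo => n Vn; apply: le_lt_trans Ve.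
by apply: ereal_sup_ubound; exists n.
Qed.

Section asymptotics.
Context {R : realType} (d : nat -> measure_display).
Context (T : forall n, measurableType (d n)).
Variables P0 P1 Q0 Q1 : forall n, probability (T n) R.
Variables L Lt : forall n, T n -> \bar R.

(** In the bound of [log_ratio_deviation_le] first fix the level dl of the lower
    tail and the level M of the upper tail; only then is the distance t taken
    small compared with the constant C that they determine. *)
Lemma log_ratio_cvg0 :
  (\forall n \near \oo, is_ac_derivative (P1 n) (P0 n) (@L n)) ->
  (\forall n \near \oo, is_ac_derivative (Q1 n) (Q0 n) (@Lt n)) ->
  (forall t : R, (0 < t)%R -> \forall n \near \oo, forall A, measurable A ->
     [/\ P0 n A <= Q0 n A + t%:E, Q0 n A <= P0 n A + t%:E,
         P1 n A <= Q1 n A + t%:E & Q1 n A <= P1 n A + t%:E]) ->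
  (forall e : R, (0 < e)%R -> exists2 dl : R, (0 < dl)%R &
     limn_esup (fun n => Q0 n [set x | Lt x < dl%:E]) < e%:E) ->
  cvg0_in_probability P0 (fun n x => lne (L x) - lne (Lt x)) /\
  cvg0_in_probability Q0 (fun n x => lne (L x) - lne (Lt x)).
Proof.
move=> Lac Ltac PQ tight.
suff near_small (e s : R) : (0 < e)%R -> (0 < s)%R -> \forall n \near \oo,
    P0 n [set x | e%:E <= `|lne (L x) - lne (Lt x)|] <= s%:E /\
    Q0 n [set x | e%:E <= `|lne (L x) - lne (Lt x)|] <= s%:E.
  split=> e e0; apply: cvg0_ereal => // s s0.
    by apply: filterS (near_small e s e0 s0) => n [].
  by apply: filterS (near_small e s e0 s0) => n [].
move=> e0 s0.
have s4 : (0 < s / 4)%R by rewrite divr_gt0.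
have [dl dl0 dls] := tight _ s4.
pose M := (s / 4)^-1%R; have M0 : (0 < M)%R by rewrite invr_gt0.
pose r := expR e; have r1 : (1 < r)%R by rewrite expR_gt1.
pose C := (r * (1 + M) / ((r - 1) * dl))%R.
have C0 : (0 < C)%R.
  by rewrite divr_gt0// mulr_gt0 ?subr_gt0// ?expR_gt0// ltr_pwDl// ltW.
(* So that t + 2 t C, plus a further t to pass from Q0 to P0, is s / 4. *)
pose t := ((s / 4) / (2 + 2 * C))%R.
have D0 : (0 < 2 + 2 * C)%R by lra.
have t0 : (0 < t)%R by rewrite divr_gt0.
have tC : (t * (2 + 2 * C) = s / 4)%R by rewrite mulfVK// gt_eqF.
near=> n.
have Ln : is_ac_derivative (P1 n) (P0 n) (@L n) by near: n.
have Ltn : is_ac_derivative (Q1 n) (Q0 n) (@Lt n) by near: n.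
have PQn : forall A, measurable A ->
     [/\ P0 n A <= Q0 n A + t%:E, Q0 n A <= P0 n A + t%:E,
         P1 n A <= Q1 n A + t%:E & Q1 n A <= P1 n A + t%:E] by near: n; exact: PQ.
have lown : Q0 n [set x | Lt x < dl%:E] < (s / 4)%:E.
  by near: n; exact: near_lt_limn_esup.
have := log_ratio_deviation_le Ln Ltn (ltW t0) dl0 M0 r1
  (fun A mA => let: And4 h _ _ _ := PQn A mA in h)
  (fun A mA => let: And4 _ h _ _ := PQn A mA in h)
  (fun A mA => let: And4 _ _ h _ := PQn A mA in h)
  (fun A mA => let: And4 _ _ _ h := PQn A mA in h) (erefl : r = expR e).
rewrite -/C invrK => Q0S.
have {}Q0S : Q0 n [set x | e%:E <= `|lne (L x) - lne (Lt x)|] <= (s - t)%:E.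
  apply: le_trans Q0S _; apply: le_trans (leeD2r _ (ltW lown)) _.
  by rewrite -EFinD lee_fin; lra.
split; last by rewrite (le_trans Q0S)// lee_fin; lra.
have [+ _ _ _] := PQn _ (log_ratio_measurable Ln Ltn e).
move=> /le_trans; apply; apply: le_trans (leeD2r _ Q0S) _.
by rewrite -EFinD lee_fin; lra.
Unshelve. all: by end_near. Qed.

End asymptotics.
Theorem theorem2p2 (R : realType) (d : nat)
  (Theta : set 'cV[R]_d) (alpha0 : 'cV[R]_d)
  (Theta_open : open Theta) (Theta_alpha0 : Theta alpha0)
  (m : nat -> nat) (m_gt0 : forall n, (0 < m n)%N)
  (X : nat -> nat -> completeMetricType R)
  (X_separable : forall n (j : 'I_(m n)), separable (X n j))
  (mu : forall n j, {sigma_finite_measure set borel (X n j) -> \bar R})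
  (eps : nat -> 'M[R]_d)
  (eps_unit : forall n, eps n \in unitmx)
  (eps_cvg0 : op_norm (eps n) @[n --> \oo] --> (0 : R)%R)
  (P : forall n, 'cV[R]_d -> probability (borel (prodX (X n) (m n))) R)
  (p : forall n, 'cV[R]_d ->
     forall j : 'I_(m n), prodX (X n) j -> X n j -> R)
  (P_density : forall n alpha (j : 'I_(m n)), Theta alpha ->
     exists Q : R.-pker borel (prodX (X n) j) ~> borel (X n j),
       [/\ is_conditional_law (T1 := borel (prodX (X n) j))
             (T2 := borel (X n j)) (P n alpha) (past j) (fun x => x j) Q,
           forall y, Q y `<< mu n j &
           forall y, is_density (mu n j) (Q y) (p n alpha j y)])
  (pt : forall n, 'cV[R]_d ->
     forall j : 'I_(m n), prodX (X n) j -> X n j -> R)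
  (pt_kernel : forall n alpha (j : 'I_(m n)), Theta alpha ->
     exists k : R.-ker borel (prodX (X n) j) ~> borel (X n j),
       forall y, is_density (mu n j) (k y) (pt n alpha j y))
  (pt_mass : forall n alpha (j : 'I_(m n)) (y : prodX (X n) j), Theta alpha ->
     \int[mu n j]_x (pt n alpha j y x)%:E != 0 /\
     \int[mu n j]_x (pt n alpha j y x)%:E < +oo)
  (Pt : forall n, 'cV[R]_d -> probability (borel (prodX (X n) (m n))) R)
  (PtE : forall n alpha, Theta alpha ->
     forall A : set (borel (prodX (X n) (m n))), measurable A ->
     Pt n alpha A = iterated_integral (mu n) (fun x : prodX (X n) (m n) =>
       (\1_A x * normalized_product (mu n) (pt n alpha) x)%:E))
  (K : forall n, 'I_(m n) -> set (borel (prodX (X n) (m n))))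
  (K_past : forall n (j : 'I_(m n)), (0 < j)%N ->
     g_sigma_algebra_preimage (past j : _ -> borel (prodX (X n) j)) (K n j))
  (L Lt : forall n, 'cV[R]_d -> borel (prodX (X n) (m n)) -> \bar R)
  (LE : forall n h, Theta (alpha0 + eps n *m h)%R ->
     is_ac_derivative (P n (alpha0 + eps n *m h)%R) (P n alpha0) (L n h))
  (LtE : forall n h, Theta (alpha0 + eps n *m h)%R ->
     is_ac_derivative (Pt n (alpha0 + eps n *m h)%R) (Pt n alpha0) (Lt n h)) :
  (forall e : R, (0 < e)%R -> exists N : nat, forall n, (N <= n)%N ->
     ereal_sup [set P n alpha
                  (\bigcup_(j in [set j : 'I_(m n) | (0 < j)%N]) ~` K n j)
                | alpha in Theta] < e%:E /\
     ereal_sup [set Pt n alpha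
                  (\bigcup_(j in [set j : 'I_(m n) | (0 < j)%N]) ~` K n j)
                | alpha in Theta] < e%:E) ->
  (m n)%:R%:E * \big[maxe/-oo]_(j < m n)
     ereal_sup [set \int[mu n j]_x
                    `|p n u.1 j u.2 x - pt n u.1 j u.2 x|%:E
                | u in Theta `*` [set y | (0 < j)%N -> (past j @` K n j) y]]
     @[n --> \oo] --> 0 ->
  ereal_sup [set tv_norm (charge_sub (P n alpha) (Pt n alpha))
             | alpha in Theta] @[n --> \oo] --> 0 /\
  ((forall (e : R) (h : 'cV[R]_d), (0 < e)%R -> exists2 delta : R,
      (0 < delta)%R &
      limn_esup (fun n => Pt n alpha0 [set x | Lt n h x < delta%:E]) < e%:E) ->
   forall h : 'cV[R]_d,
     cvg0_in_probability (fun n => P n alpha0)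
       (fun n x => lne (L n h x) - lne (Lt n h x)) /\
     cvg0_in_probability (fun n => Pt n alpha0)
       (fun n x => lne (L n h x) - lne (Lt n h x))).
Proof.
move=> PK pc.
have close (t : R) : (0 < t)%R -> \forall n \near \oo, forall alpha, Theta alpha ->
    forall A, measurable A ->
    P n alpha A <= Pt n alpha A + t%:E /\ Pt n alpha A <= P n alpha A + t%:E.
  move=> t0.
  have t2 : (0 < t / 2)%R by rewrite divr_gt0.
  have t4 : (0 < t / 4)%R by rewrite divr_gt0.
  have [N PKN] := PK _ t2.
  have pcn : \forall n \near \oo, forall alpha (j : 'I_(m n)) (y : prodX (X n) j),
      Theta alpha -> ((0 < j)%N -> (past j @` K n j) y) ->
      \int[mu n j]_x `|p n alpha j y x - pt n alpha j y x|%:E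
        <= (t / 4 / (m n)%:R)%:E.
    have near0 : nbhs (0 : \bar R) [set x | x < (t / 4)%:E].
      by apply: open_nbhs_nbhs; split; [exact: open_ereal_lt_ereal|rewrite /= lte_fin].
    apply: (filterS _ (pc _ near0 : nbhs \oo _)) => n /= pcn alpha j y Talpha yK.
    have mn0 : (0 < (m n)%:R :> R)%R by rewrite ltr0n.
    rewrite leNgt; apply/negP => cI.
    have : (m n)%:R%:E * (t / 4 / (m n)%:R)%:E < (t / 4)%:E.
      apply: le_lt_trans pcn; rewrite lee_pmul2l ?lte_fin//.
      apply: le_trans (ltW cI) _; apply: le_trans (le_bigmax _ _ j).
      by apply: ereal_sup_ubound; exists (alpha, y).
    by rewrite -EFinM mulrC mulfVK ?gt_eqF// ltxx.
  near=> n => alpha Talpha A mA.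
  have Nn : (N <= n)%N by near: n; exact: nbhs_infty_ge.
  have [PKn PtKn] := PKN n Nn.
  have pcnn : forall alpha (j : 'I_(m n)) (y : prodX (X n) j),
      Theta alpha -> ((0 < j)%N -> (past j @` K n j) y) ->
      \int[mu n j]_x `|p n alpha j y x - pt n alpha j y x|%:E
        <= (t / 4 / (m n)%:R)%:E by near: n; exact: pcn.
  have mn0 : (0 < (m n)%:R :> R)%R by rewrite ltr0n.
  pose c := ((t / 4) / (m n)%:R)%R.
  have c0 : (0 <= c)%R by rewrite divr_ge0// ltW.
  rewrite (_ : t = (c + c) *+ m n + t / 2)%R; last first.
    rewrite -mulr_natr mulrDl mulfVK ?gt_eqF//; lra.
  apply: (@probability_difference_le R (X n) (m n) (X_separable n) (mu n) (P n alpha)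
    (Pt n alpha) (p n alpha) (pt n alpha) _ _ _ _ (K n)) => //.
  - by move=> j; exact: P_density.
  - by move=> j; exact: pt_kernel.
  - by move=> j y; exact: pt_mass.
  - by move=> A' mA'; exact: PtE.
  - exact: K_past.
  - by rewrite (le_trans _ (ltW PKn))//; apply: ereal_sup_ubound; exists alpha.
  - by rewrite (le_trans _ (ltW PtKn))//; apply: ereal_sup_ubound; exists alpha.
  move=> j y yK; apply: pcnn => //.
split.
  apply: cvg0_ereal => [n|e e0].
    apply: le_ereal_sup_tmp; exists (tv_norm (charge_sub (P n alpha0) (Pt n alpha0))).
      by exists alpha0.
    exact: tv_norm_ge0.
  have e2 : (0 < e / 2)%R by rewrite divr_gt0.
  apply: filterS (close _ e2) => n closen.
  apply: ge_ereal_sup => _ [alpha Talpha <-]; rewrite [e]splitr.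
  by apply: tv_norm_le => A mA; have [] := closen alpha Talpha A mA.
move=> tight h.
have Thetah := mulmx_near_translate h Theta_open Theta_alpha0 eps_cvg0.
apply: (log_ratio_cvg0 (P1 := fun n => P n (alpha0 + eps n *m h)%R)
  (Q1 := fun n => Pt n (alpha0 + eps n *m h)%R)).
- by apply: filterS Thetah => n; exact: LE.
- by apply: filterS Thetah => n; exact: LtE.
- move=> t t0; apply: filterS2 (close t t0) Thetah => n closen Th A mA.
  have [? ?] := closen _ Theta_alpha0 A mA.
  by have [? ?] := closen _ Th A mA.
- by move=> e e0; exact: tight.
Unshelve. all: by end_near. Qed.
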